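(* For every integer $t\ge 0$ with $t\ne 1$, there exists a $(12t+10,3,2)$-BIBD $(X,\mathcal{A})$ with a strong nesting $\phi:\mathcal{A}\to Y$, $X\subseteq Y$, where $|Y|=w=18t+16$, and this is optimal: no strong nesting of a $(12t+10,3,2)$-BIBD uses fewer points.
   Context: A $(v,k,\lambda)$-BIBD is a pair $(X,\mathcal{A})$ where $X$ is a set of $v$ points and $\mathcal{A}$ is a multiset of $k$-subsets of $X$ (blocks) such that every pair of distinct points lies in exactly $\lambda$ blocks. Given a $(v,k,\lambda)$-BIBD $(X,\mathcal{A})$ and a set $Y\supseteq X$ with $|Y|=w$, a map $\phi:\mathcal{A}\to Y$ is a strong nesting if (1) $\phi(A)\notin A$ for every block $A\in\mathcal{A}$, and (2) the multiset of pairs $\{\{x,\phi(A)\}: A\in\mathcal{A},\ x\in A\}$ (one pair for each block $A$, counted with multiplicity in $\mathcal{A}$, and each $x\in A$) consists of distinct pairs. A strong nesting is optimal if $w=|Y|$ is as small as possible. *)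

(* Defs.v *)
From mathcomp Require Import all_boot.
Set Implicit Arguments. Unset Strict Implicit. Unset Printing Implicit Defensive.

(* The point universe Y is a finite type T; the point set X is a subset of T.
   The multiset of blocks is a sequence (repetitions allowed). *)
Definition is_BIBD (T : finType) (X : {set T}) (v k lam : nat)
    (blocks : seq {set T}) : Prop :=
  #|X| = v /\
  (forall B, B \in blocks -> B \subset X /\ #|B| = k) /\
  (forall x y, x \in X -> y \in X -> x != y ->
     count (fun B : {set T} => (x \in B) && (y \in B)) blocks = lam).

(* The block with index i (occurrences of a block in the multiset are
   distinguished by their index). *)
Definition block_at (T : finType) (blocks : seq {set T})
    (i : 'I_(size blocks)) : {set T} := nth set0 blocks i.

Definition nesting_pairs (T : finType) (blocks : seq {set T})
    (phi : 'I_(size blocks) -> T) : seq {set T} :=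
  [seq [set x; phi i] | i <- enum 'I_(size blocks), x <- enum (block_at i)].

(* Strong nesting phi : A -> Y, where Y is the whole type T (so w = #|T|). *)
Definition strong_nesting (T : finType) (blocks : seq {set T})
    (phi : 'I_(size blocks) -> T) : Prop :=
  (forall i, phi i \notin block_at i) /\ uniq (nesting_pairs phi).

(* Main.v *)
From HB Require Import structures.
Require Import Defs.
From mathcomp Require Import all_boot all_algebra.
From mathcomp Require Import zify.
Set Implicit Arguments. Unset Strict Implicit. Unset Printing Implicit Defensive.
Import GRing.Theory.

(** Lower bound. At a point x of X, the blocks nested at x and the images of the
blocks through x use different pairs at x, so at most (w - v) / 3 blocks are nested
at x; at a point outside X at most v / 3 blocks are nested, since they are disjoint.
For w < 18t + 16 these two bounds, rounded down, do not add up to the number of blocks.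

Existence. Put u = 2t + 1, so that v = 6u + 4 and w = 9u + 7. The points are u groups,
each of 6 points of X and 3 further points, and a hole of 4 points of X and 3 further
points; the hole carries a nested (4,3,2)-design, so it suffices to build the design
with a hole, for odd u >= 3 (for u = 1 it does not exist, and a nested (10,3,2)-design
is given explicitly). A frame over an abelian group G uses exactly the pairs between
different groups, the groups being indexed by G. Multiplying a frame by a transversal
design TD(4, m) and filling its groups with designs with a hole on m groups gives u = |G| m.
There are frames for G = F_p with p >= 5 prime and for G = F_9: the blocks are d B + g,
where B runs over a fixed list of base blocks, g over G, and d over a set D containing
exactly one of z, -z for each z <> 0. Hence it remains to give the cases u = 3, u = 9 and u = p
prime, p >= 5; the last one is the frame over F_p with the base blocks for d = 1
replaced by a list that also uses the hole. *)

(* A block {q 1, q 2, q 3} with nesting point q 0 is a function q on nat; [tri] and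
   [star] list the ordered slots of its pairs, resp. of its nesting pairs, so that each
   unordered pair is counted once as (x, y) and once as (y, x). *)
Definition tri : seq (nat * nat) := [:: (1, 2); (2, 1); (1, 3); (3, 1); (2, 3); (3, 2)].
Definition star : seq (nat * nat) := [:: (0, 1); (1, 0); (0, 2); (2, 0); (0, 3); (3, 0)].

Definition cover (T : eqType) (S : seq (nat * nat)) (q : nat -> T) (x y : T) : nat :=
  \sum_(s <- S) ((q s.1 == x) && (q s.2 == y)).

Definition covers (T : eqType) S (L : seq (nat -> T)) (x y : T) : nat :=
  \sum_(q <- L) cover S q x y.

(** * From pair counts to a nested design *)

Lemma uniq_map_inj_in (T1 T2 : eqType) (f : T1 -> T2) (s : seq T1) :
  uniq (map f s) -> {in s &, injective f}.
Proof.
move=> us x y xs ys fxy; have x0 := x.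
rewrite -(nth_index x0 xs) -(nth_index x0 ys); congr nth; apply/eqP.
rewrite -(nth_uniq (f x0) _ _ us) ?size_map ?index_mem //.
by rewrite !(nth_map x0) ?index_mem // !nth_index // fxy.
Qed.

Lemma sum_bool_le1 (I : finType) (f : I -> bool) :
  (forall i j, f i -> f j -> i = j) -> \sum_i (f i : nat) <= 1.
Proof.
move=> fu; rewrite -big_mkcond /= sum1_card.
by apply/card_le1_eqP => i j fi fj; apply: fu.
Qed.

Lemma sum_mem_subset (T : finType) (A X : {set T}) :
  A \subset X -> \sum_(x in X) (x \in A) = #|A|.
Proof.
move=> sAX; rewrite -big_mkcondr sum1_card; apply: eq_card => x; rewrite [LHS]unfold_in.
by apply: andb_idl; apply: (subsetP sAX).
Qed.

Lemma ord_iota n (i : 'I_n) : (i : nat) \in iota 0 n.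
Proof. by rewrite mem_iota ltn_ord. Qed.

(** The counts at [(x, x)] vanish, so the four points of each quadruple are distinct; every point of
    a triple has a positive [tri] count, so it lies in [X]. A nesting pair shared by two blocks
    would be counted twice at one ordered pair, against the [star] bound. *)
Lemma quad_design (T : finType) (X : {set T}) (L : seq (nat -> T)) :
  (forall x y, covers tri L x y = 2 * [&& x != y, x \in X & y \in X]) ->
  (forall x y, covers star L x y <= (x != y)) ->
  exists (blocks : seq {set T}) (phi : 'I_(size blocks) -> T),
    is_BIBD X #|X| 3 2 blocks /\ strong_nesting phi.
Proof.
move=> triL starL; pose Q (i : 'I_(size L)) := tnth (in_tuple L) i.
have coversE S x y : covers S L x y = \sum_i cover S (Q i) x y by rewrite /covers big_tnth.
have disj i : uniq [:: Q i 0; Q i 1; Q i 2; Q i 3].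
  have t0 x : cover tri (Q i) x x = 0.
    apply/eqP; rewrite -leqn0; have := triL x x; rewrite eqxx /= muln0 coversE => h.
    by rewrite -[X in _ <= X]h (bigD1 i) //= leq_addr.
  have s0 x : cover star (Q i) x x = 0.
    apply/eqP; rewrite -leqn0; have := starL x x; rewrite eqxx /= coversE.
    by apply: leq_trans; rewrite (bigD1 i) //= leq_addr.
  have := t0 (Q i 1); have := t0 (Q i 2); have := s0 (Q i 0).
  rewrite /cover /tri /star !big_cons !big_nil /= !eqxx !andbT !inE.
  move: (Q i 0) (Q i 1) (Q i 2) (Q i 3) => e a b c.
  rewrite (eq_sym a e) (eq_sym b e) (eq_sym c e) (eq_sym b a) (eq_sym c a) (eq_sym c b).
  by do !case: (_ == _).
have sub i k : 0 < k < 4 -> Q i k \in X.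
  (* Any other slot of the triple serves as [l]: it makes a [tri] count at [Q i k] positive. *)
  move=> hk; pose l := if k == 1 then 2 else 1.
  have: 0 < covers tri L (Q i k) (Q i l).
    rewrite coversE (bigD1 i) //= ltn_addr // /cover /tri !big_cons !big_nil /l.
    by move: k hk {l} => [|[|[|[|]]]] //= _; rewrite !eqxx ?addn_gt0 /= ?orbT.
  by rewrite triL; case: (Q i k \in X); rewrite ?andbF.
pose B (q : nat -> T) := [set q 1; q 2; q 3].
have sz : size (map B L) = size L by rewrite size_map.
pose phi (i : 'I_(size (map B L))) := Q (cast_ord sz i) 0.
have blk i : block_at i = B (Q (cast_ord sz i)).
  have iL : i < size L by rewrite -[X in _ < X]sz.
  rewrite /block_at (nth_map (Q (cast_ord sz i))) //.
  by rewrite [in RHS]/Q (tnth_nth (Q (cast_ord sz i))).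
have memP x i : x \in B (Q i) -> [/\ x != Q i 0 & x \in X].
  have := disj i; rewrite /= !inE => /and4P [h1 _ _ _].
  move: h1; rewrite !negb_or => /and3P [a b c].
  by rewrite -orbA; case/or3P => /eqP ->; rewrite sub // eq_sym.
exists (map B L), phi; split; last split.
- split=> //; split.
    move=> A /(nthP set0) [k]; rewrite sz => kL <-.
    rewrite (nth_map (Q (Ordinal kL))) // -(tnth_nth _ (in_tuple L) (Ordinal kL)).
    split; first by apply/subsetP => x /memP [].
    have := disj (Ordinal kL); rewrite /= !inE => /and4P [_ h2 h3 _].
    rewrite -/(Q _) /B setUC cardsU1 cards2 !inE; move: h2 h3.
    by rewrite !(eq_sym _ (Q _ 3)) !negb_or => /andP [-> ->] ->.
  move=> x y xX yX nxy; rewrite count_map -sum1_count big_mkcond /=.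
  have := triL x y; rewrite nxy xX yX muln1 => h; rewrite -[RHS]h coversE big_tnth.
  apply: eq_bigr => i _; rewrite -/(Q i) /cover /tri !big_cons !big_nil /= !inE.
  have := disj i; rewrite /= !inE => /and4P [_ h2 h3 _]; move: h2 h3 nxy.
  move: (Q i 1) (Q i 2) (Q i 3) => a b c.
  rewrite negb_or => /andP [ab ac] bc xy; rewrite !(eq_sym a) !(eq_sym b) !(eq_sym c).
  have dj (u v w : T) : u != v -> (w == u) && (w == v) = false.
    by move=> uv; apply/negP => /andP [/eqP -> /eqP e]; rewrite e eqxx in uv.
  have xe (u : T) : (x == u) && (y == u) = false.
    by apply/negP => /andP [/eqP <- /eqP e]; rewrite e eqxx in xy.
  move: (dj a b x ab) (dj a c x ac) (dj b c x bc) (dj a b y ab) (dj a c y ac) (dj b c y bc).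
  move: (xe a) (xe b) (xe c).
  by do !case: (_ == _).
- by move=> i; rewrite blk; apply/negP => /memP [] /eqP.
- apply: allpairs_uniq_dep => [|i _|[i x] [i' x']].
  + exact: enum_uniq.
  + exact: enum_uniq.
  case/allpairsPdep => j [z [_ + [-> zz]]]; rewrite {}zz mem_enum => xi.
  case/allpairsPdep => j' [z' [_ + [-> zz]]]; rewrite {}zz mem_enum => xi' /= e.
  have star_pos k u : u \in B (Q k) ->
      0 < cover star (Q k) u (Q k 0) /\ 0 < cover star (Q k) (Q k 0) u.
    rewrite /cover /star !big_cons !big_nil !inE -orbA.
    by case/or3P => /eqP ->; rewrite /= !eqxx ?addn_gt0 /= ?orbT.
  move: xi xi'; rewrite !blk => xi xi'.
  (* Within one block the point is determined, because it differs from the nesting point. Two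
     different blocks would both contribute to the [star] count at [(z, phi j)]. *)
  have [ej|nj] := eqVneq j j'.
    rewrite -ej in e xi' *; have [nz _] := memP _ _ xi.
    suff -> : z = z' by [].
    by have: z \in [set z'; phi j]; [rewrite -e set21 | rewrite !inE (negPf nz) orbF => /eqP].
  have : 2 <= covers star L z (phi j).
    rewrite coversE (bigD1 (cast_ord sz j)) //= (bigD1 (cast_ord sz j')) /=; last first.
      by rewrite eq_sym; apply: contraNneq nj => /cast_ord_inj ->.
    have [p1 _] := star_pos _ _ xi; have [p2 p3] := star_pos _ _ xi'.
    have : 0 < cover star (Q (cast_ord sz j')) z (phi j).
      have [nz _] := memP _ _ xi; have [nz' _] := memP _ _ xi'.
      have: z \in [set z'; phi j'] by rewrite -e set21.
      have: phi j \in [set z'; phi j'] by rewrite -e set22.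
      rewrite !inE => /orP [] /eqP e1 /orP [] /eqP e2; rewrite ?e1 ?e2 //.
      - by move: nz; rewrite e2 -e1 eqxx.
      - by move: nz; rewrite -/(phi j) e2 -e1 eqxx.
    by move: p1; rewrite /phi; lia.
  by move=> h; have := leq_trans h (starL _ _); case: (z != _).
Qed.

(** * The lower bound on the number of points *)

Lemma nesting_lower_bound (t : nat) (T : finType) (X : {set T}) (blocks : seq {set T})
    (phi : 'I_(size blocks) -> T) :
  is_BIBD X (12 * t + 10) 3 2 blocks -> strong_nesting phi -> 18 * t + 16 <= #|T|.
Proof.
move=> [cX [blkX lamX]] [phiN uN].
have inX (i : 'I_(size blocks)) : block_at i \subset X by case: (blkX _ (mem_nth set0 (ltn_ord i))).
have card3 (i : 'I_(size blocks)) : #|block_at i| = 3 by case: (blkX _ (mem_nth set0 (ltn_ord i))).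
have inj (i : 'I_(size blocks)) x (i' : 'I_(size blocks)) x' : x \in block_at i -> x' \in block_at i' ->
    [set x; phi i] = [set x'; phi i'] -> i = i'.
  (* Each nesting pair is tagged with its block, so that uniqueness of the list of pairs becomes
     injectivity on the tags. *)
  move=> xi xi' e; pose s := [seq (i, x) | i <- enum 'I_(size blocks), x <- enum (block_at i)].
  have us : uniq (map (fun p => [set p.2; phi p.1]) s) by rewrite map_allpairs.
  have ms j z : z \in block_at j -> (j, z) \in s.
    by move=> zj; apply/allpairsPdep; exists j, z; rewrite !mem_enum.
  by case: (uniq_map_inj_in us (ms _ _ xi) (ms _ _ xi') e).
pose N y := \sum_(i < size blocks) (phi i == y).
have rep x : x \in X -> \sum_(i < size blocks) (x \in block_at i) = 12 * t + 9.
  (* A block through x has two further points, and each of the v - 1 other points is met twice: 2 r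
     = 2 (v - 1). *)
  move=> xX; suff: 2 * \sum_(i < size blocks) (x \in block_at i) = 2 * (12 * t + 9) by lia.
  have -> : 2 * (12 * t + 9) = \sum_(y in X :\ x) 2.
    by rewrite sum_nat_const mulnC; have := cardsD1 x X; rewrite xX cX => h; congr (_ * _); lia.
  rewrite big_distrr /=.
  rewrite (eq_bigr (fun y => \sum_(i < size blocks) ((x \in block_at i) && (y \in block_at i)))).
    rewrite exchange_big /=; apply: eq_bigr => i _.
    case xi: (x \in block_at i) => /=; last by rewrite big1.
    have := card3 i; rewrite (cardsD1 x) xi -(sum_mem_subset (setSD _ (inX i))) => - [<-].
    by rewrite muln1; apply: eq_bigr => y; rewrite !inE => /andP [-> _].
  move=> y; rewrite !inE => /andP [nyx yX]; rewrite eq_sym in nyx.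
  by rewrite -(lamX x y xX yX nyx) -sum1_count big_mkcond (big_nth set0) big_mkord.
(* Incidences of points and blocks, counted both ways: 3 b = v r. *)
have nb : size blocks = (12 * t + 10) * (4 * t + 3).
  suff: 3 * size blocks = 3 * ((12 * t + 10) * (4 * t + 3)) by lia.
  transitivity (\sum_(x in X) \sum_(i < size blocks) (x \in block_at i)); last first.
    by rewrite (eq_bigr _ rep) sum_nat_const cX; lia.
  rewrite exchange_big /= (eq_bigr (fun=> 3)) ?sum_nat_const ?card_ord 1?mulnC //.
  by move=> i _; rewrite sum_mem_subset.
(* A block through z nested at x and a block through x nested at z both use the pair {x, z}, so each
   z other than x is counted at most once. The inequality is strict because x itself is not
   counted. *)
have nin x : x \in X -> 3 * N x + (12 * t + 9) < #|T|.
  move=> xX.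
  have -> : 3 * N x = \sum_z \sum_(i < size blocks) ((phi i == x) && (z \in block_at i)).
    rewrite exchange_big /= big_distrr /=; apply: eq_bigr => i _.
    case: eqP => /= _; last by rewrite big1.
    by rewrite -(card3 i) -(sum_mem_subset (subsetT _)) muln1; apply: eq_bigl => z; rewrite inE.
  have -> : 12 * t + 9 = \sum_z \sum_(i < size blocks) ((x \in block_at i) && (phi i == z)).
    rewrite exchange_big /= -(rep x xX); apply: eq_bigr => i _.
    case: (x \in _) => /=; last by rewrite big1.
    by rewrite (bigD1 (phi i)) //= eqxx big1 // => z /negPf; rewrite eq_sym => ->.
  rewrite -big_split (bigD1 x) //=.
  have -> : \sum_(i < size blocks) ((phi i == x) && (x \in block_at i)) = 0.
    by apply: big1 => i _; case: eqP (phiN i) => //= -> /negPf ->.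
  have -> : \sum_(i < size blocks) ((x \in block_at i) && (phi i == x)) = 0.
    by apply: big1 => i _; rewrite andbC; case: eqP (phiN i) => //= -> /negPf ->.
  rewrite !add0n.
  have -> : #|T| = (\sum_(z | z != x) 1).+1.
    by rewrite sum1_card -cardsT (cardsD1 x) inE; congr _.+1; apply: eq_card => z; rewrite !inE andbT.
  rewrite ltnS; apply: leq_sum => z zx; rewrite -big_split /=.
  rewrite (eq_bigr (fun i => ((phi i == x) && (z \in block_at i))
                          || ((x \in block_at i) && (phi i == z)) : nat)); last first.
    move=> i _; case: eqP => //= e; case: eqP => //=; last by rewrite andbF orbF addn0.
    by rewrite e => /eqP; rewrite eq_sym (negPf zx).
  apply: sum_bool_le1 => i j.
  have key (k : 'I_(size blocks)) : ((phi k == x) && (z \in block_at k)) || ((x \in block_at k) && (phi k == z)) ->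
      exists2 u, u \in block_at k & [set u; phi k] = [set x; z].
    case/orP => /andP [].
      by move=> /eqP <- zk; exists z => //; rewrite setUC.
    by move=> xk /eqP <-; exists x.
  by move=> /key [u ui eu] /key [w wj ew]; apply: (inj _ u _ w) => //; rewrite eu.
have nout y : 3 * N y <= 12 * t + 10.
  have -> : 3 * N y = \sum_(z in X) \sum_(i < size blocks) ((phi i == y) && (z \in block_at i)).
    rewrite exchange_big /= big_distrr /=; apply: eq_bigr => i _.
    by case: eqP => /= _; [rewrite sum_mem_subset // card3 | rewrite big1].
  rewrite -cX -sum1_card; apply: leq_sum => z _; apply: sum_bool_le1 => i j.
  by move=> /andP [/eqP ei zi] /andP [/eqP ej zj]; apply: (inj _ z _ z) => //; rewrite ei ej.
have tot : size blocks = \sum_(y in X) N y + \sum_(y in ~: X) N y.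
  transitivity (\sum_y N y).
    rewrite exchange_big /= (eq_bigr (fun=> 1)) ?sum_nat_const ?card_ord ?muln1 //.
    by move=> i _; rewrite (bigD1 (phi i)) //= eqxx big1 // => z /negPf; rewrite eq_sym => ->.
  by rewrite (bigID (mem X)) /=; congr (_ + _); apply: eq_bigl => y; rewrite inE.
rewrite leqNgt; apply/negP => small.
have cC : #|~: X| <= 6 * t + 5 by have := cardsC X; lia.
have b1 : \sum_(y in X) N y <= (12 * t + 10) * (2 * t + 1).
  rewrite -cX -sum_nat_const; apply: leq_sum => y yX; have := nin y yX; lia.
have b2 : \sum_(y in ~: X) N y <= (6 * t + 5) * (4 * t + 3).
  apply: leq_trans (leq_mul cC (leqnn _)); rewrite -sum_nat_const; apply: leq_sum => y _.
  by have := nout y; lia.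
(* The bounds add up to (6t + 5)(8t + 5), whereas there are (6t + 5)(8t + 6) blocks. *)
by nia.
Qed.

(** * Designs with a hole *)

(* Colours 0-5 of each group and points 0-3 of the hole belong to X. *)
Definition point (I : Type) : Type := (I * 'I_9 + 'I_7)%type.

Definition inner (I : Type) (x : point I) : bool :=
  match x with inl (_, c) => c < 6 | inr h => h < 4 end.

Definition in_hole (I : Type) (x : point I) : bool := if x is inr _ then true else false.

(** Neither kind of pair may lie inside the hole, so that several such designs can share one hole,
    which is filled only once at the end. *)
Definition incomplete (I : finType) (L : seq (nat -> point I)) : Prop :=
  (forall x y, covers tri L x y
     = 2 * [&& x != y, inner x, inner y & ~~ (in_hole x && in_hole y)]) /\
  (forall x y, covers star L x y <= [&& x != y & ~~ (in_hole x && in_hole y)]).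

(* Base blocks list (colour, position) pairs; the colours 9-15 stand for the points of
   the hole, whose position is irrelevant. *)
Definition diffs (G : zmodType) (S : seq (nat * nat)) (B : seq (seq (nat * G)))
    (a b : nat) : seq G :=
  flatten [seq [seq ((nth (0, 0) q s.2).2 - (nth (0, 0) q s.1).2)%R
    | s <- S & ((nth (0, 0%R) q s.1).1 == a) && ((nth (0, 0%R) q s.2).1 == b)] | q <- B].

Lemma size_diffs (G : zmodType) S (B : seq (seq (nat * G))) a b :
  size (diffs S B a b) =
  \sum_(q <- B) \sum_(s <- S)
    (((nth (0, 0%R) q s.1).1 == a) && ((nth (0, 0%R) q s.2).1 == b)).
Proof.
rewrite size_flatten sumnE !big_map; apply: eq_bigr => q _.
by rewrite size_map size_filter -sum1_count big_mkcond.
Qed.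

Lemma count_diffs (G : zmodType) S (B : seq (seq (nat * G))) a b (P : pred G) :
  count P (diffs S B a b) =
  \sum_(q <- B) \sum_(s <- S)
    [&& (nth (0, 0%R) q s.1).1 == a, (nth (0, 0%R) q s.2).1 == b &
        P ((nth (0, 0%R) q s.2).2 - (nth (0, 0%R) q s.1).2)%R].
Proof.
rewrite count_flatten sumnE !big_map; apply: eq_bigr => q _.
rewrite count_map -sum1_count big_filter_cond big_mkcond; apply: eq_bigr => s _ /=.
by rewrite andbA.
Qed.

Lemma coversC (T : eqType) S (L : seq (nat -> T)) x y :
  perm_eq [seq (s.2, s.1) | s <- S] S -> covers S L x y = covers S L y x.
Proof.
move=> pS; apply: eq_bigr => q _; rewrite /cover.
transitivity (\sum_(s <- [seq (s.2, s.1) | s <- S]) ((q s.1 == x) && (q s.2 == y))).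
  by apply/esym/perm_big.
rewrite big_map.
by apply: eq_bigr => s _; rewrite andbC.
Qed.

Lemma triC : perm_eq [seq (s.2, s.1) | s <- tri] tri. Proof. by []. Qed.
Lemma starC : perm_eq [seq (s.2, s.1) | s <- star] star. Proof. by []. Qed.

Definition valid_colours (G : zmodType) n (B : seq (seq (nat * G))) :=
  all (all (fun cp => cp.1 < n)) B.

Lemma nth_colour (G : zmodType) n (q : seq (nat * G)) k :
  all (fun cp => cp.1 < n.+1) q -> (nth (0, 0%R) q k).1 < n.+1.
Proof.
move=> /all_nthP -/(_ (0, 0%R)) qn; case: (ltnP k (size q)) => [|hk]; first exact: qn.
(* Past the end of the list the default has colour 0, which is valid. *)
by rewrite nth_default.
Qed.

Lemma eq_sum_valid (G : zmodType) n (B : seq (seq (nat * G))) (F1 F2 : seq (nat * G) -> nat) :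
  valid_colours n B -> (forall q, all (fun cp => cp.1 < n) q -> F1 q = F2 q) ->
  \sum_(q <- B) F1 q = \sum_(q <- B) F2 q.
Proof.
move=> /allP vB eF; rewrite big_seq [RHS]big_seq; apply: eq_bigr => q qB.
exact/eF/vB.
Qed.

(** * Developing base blocks over a finite abelian group *)

Section Development.

Variable G : finZmodType.

Definition place (g : G) (cp : nat * G) : point G :=
  if cp.1 < 9 then inl ((cp.2 + g)%R, inord cp.1) else inr (inord (cp.1 - 9)).

Definition develop (B : seq (seq (nat * G))) : seq (nat -> point G) :=
  [seq (fun k => place g (nth (0, 0%R) q k)) | g <- enum G, q <- B].

Lemma covers_develop S B X Y :
  covers S (develop B) X Y =
  \sum_(q <- B) \sum_(s <- S) \sum_g
    ((place g (nth (0, 0%R) q s.1) == X) && (place g (nth (0, 0%R) q s.2) == Y)).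
Proof.
rewrite /covers /develop big_allpairs_dep big_enum /= exchange_big /=.
by apply: eq_bigr => q _; rewrite exchange_big.
Qed.

Lemma place_eq_inl g cp (x : G) (a : 'I_9) :
  (place g cp == inl (x, a)) = (cp.1 == a) && (g == x - cp.2)%R.
Proof.
rewrite /place; case: ltnP => h.
  rewrite /eq_op /= -/(eq_op (_, _) _) xpair_eqE andbC -val_eqE /= inordK //.
  by congr (_ && _); rewrite addrC eq_sym -subr_eq eq_sym.
by apply/esym/negP => /andP [/eqP e _]; have := ltn_ord a; rewrite -e ltnNge h.
Qed.

Lemma place_eq_inr g cp (h : 'I_7) :
  cp.1 < 16 -> (place g cp == inr h) = (cp.1 == 9 + h).
Proof.
move=> c16; rewrite /place; case: ltnP => hc; first by apply/esym/negbTE; lia.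
rewrite /eq_op /= -/(eq_op _ _) -val_eqE /= inordK; lia.
Qed.

(** The method of differences: exactly one translate puts the first slot at x, and it puts the
    second at y exactly when the two slots differ by y - x. *)
Lemma covers_develop_inl S B x (a : 'I_9) y (b : 'I_9) :
  covers S (develop B) (inl (x, a)) (inl (y, b)) = count_mem (y - x)%R (diffs S B a b).
Proof.
rewrite covers_develop count_diffs; apply: eq_bigr => q _; apply: eq_bigr => s _.
move: (nth _ _ _) (nth _ _ _) => v u.
rewrite (bigD1 (x - u.2)%R) //= big1 => [|g /negPf ng]; last by rewrite (place_eq_inl g u) ng andbF.
rewrite !place_eq_inl eqxx andbT addn0; congr (nat_of_bool [&& _, _ & _]).
rewrite /= -subr_eq0 -[RHS]subr_eq0; congr (_ == _).
by rewrite !opprB addrACA [RHS]addrACA (addrC x).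
Qed.

Lemma covers_develop_inlr S B x (a : 'I_9) (h : 'I_7) : valid_colours 16 B ->
  covers S (develop B) (inl (x, a)) (inr h) = size (diffs S B a (9 + h)).
Proof.
move=> vB; rewrite covers_develop size_diffs; apply: eq_sum_valid vB _ => q vq.
apply: eq_bigr => s _; have := nth_colour s.2 vq.
move: (nth _ _ _) (nth _ _ _) => u v v16.
rewrite (bigD1 (x - u.2)%R) //= big1 => [|g /negPf ng]; last by rewrite (place_eq_inl g u) ng andbF.
by rewrite place_eq_inl place_eq_inr // eqxx andbT addn0.
Qed.

(** Translations fix the points of the hole, so such a pair recurs in every translate; this is why
    [hole_check] asks for empty lists here. *)
Lemma covers_develop_inr S B (h h' : 'I_7) : valid_colours 16 B ->
  covers S (develop B) (inr h) (inr h') = #|G| * size (diffs S B (9 + h) (9 + h')).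
Proof.
move=> vB; rewrite covers_develop size_diffs big_distrr; apply: eq_sum_valid vB _ => q vq.
rewrite big_distrr; apply: eq_bigr => s _.
rewrite (eq_bigr (fun=> ((nth (0, 0%R) q s.1).1 == 9 + h) && ((nth (0, 0%R) q s.2).1 == 9 + h')
  : nat)); first by rewrite sum_nat_const.
by move=> g _; rewrite !place_eq_inr ?nth_colour.
Qed.

(** Pairs that meet the hole are governed by the colours alone, hence by the sizes of the difference
    lists. Colours 9 to 12 are the points of the hole in X, whence the bound 13. *)
Definition hole_check (B : seq (seq (nat * G))) :=
  [&& valid_colours 16 B,
      all (fun a => all (fun h =>
        (size (diffs tri B a h) == 2 * ((a < 6) && (h < 13))) && (size (diffs star B a h) <= 1))
        (iota 9 7)) (iota 0 9) &
      all (fun h => all (fun h' => nilp (diffs tri B h h') && nilp (diffs star B h h'))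
        (iota 9 7)) (iota 9 7)].

(** Only the difference 0 within one colour, a point paired with itself, is excluded; the difference
    0 between two colours is a pair inside a group and has to be covered. *)
Lemma develop_incomplete B : hole_check B ->
  (forall (a b : 'I_9) z, count_mem z (diffs tri B a b) =
     2 * [&& a < 6, b < 6 & ~~ ((z == 0%R) && (a == b))]) ->
  (forall (a b : 'I_9) z, count_mem z (diffs star B a b) <= ~~ ((z == 0%R) && (a == b))) ->
  incomplete (develop B).
Proof.
case/and3P => vB /allP ah /allP hh triB starB.
have mem7 (h : 'I_7) : 9 + h \in iota 9 7 by rewrite mem_iota leq_addr ltn_add2l ltn_ord.
split; case=> [[x a]|h]; case=> [[y b]|h'] /=.
- rewrite covers_develop_inl triB /= andbT; congr (2 * nat_of_bool _).
  rewrite subr_eq0 (eq_sym y) /eq_op /= -/(eq_op (_, _) _) xpair_eqE.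
  by rewrite andbCA [RHS]andbCA; case: (_ < 6); case: (_ < 6); rewrite ?andbT ?andbF.
- rewrite covers_develop_inlr //.
  have /andP [/eqP -> _] := allP (ah _ (ord_iota a)) _ (mem7 h').
  by rewrite andbT ltn_add2l.
- rewrite coversC ?triC // covers_develop_inlr //.
  have /andP [/eqP -> _] := allP (ah _ (ord_iota b)) _ (mem7 h).
  by rewrite andbT ltn_add2l andbC.
- rewrite covers_develop_inr //.
  have /andP [/nilP -> _] := allP (hh _ (mem7 h)) _ (mem7 h').
  by rewrite !andbF !muln0.
- rewrite covers_develop_inl andbT; apply: leq_trans (starB _ _ _) _.
  by rewrite subr_eq0 (eq_sym y).
- rewrite covers_develop_inlr //.
  by have /andP [_ ->] := allP (ah _ (ord_iota a)) _ (mem7 h').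
- rewrite coversC ?starC // covers_develop_inlr //.
  by have /andP [_ ->] := allP (ah _ (ord_iota b)) _ (mem7 h).
- rewrite covers_develop_inr //.
  have /andP [_ /nilP ->] := allP (hh _ (mem7 h)) _ (mem7 h').
  by rewrite muln0.
Qed.

End Development.

(** * Transversal designs TD(4, m) for odd m *)

(** An orthogonal array of strength 2 and index 1: the rows are the pairs [(i, j)], and the four
    columns [mu 0], ..., [mu 3] match the nesting point and the three points of a block. *)
Definition transversal (I : finType) (mu : nat -> I -> I -> I) : Prop :=
  forall k l a b, k < 4 -> l < 4 -> k != l ->
    \sum_i \sum_j ((mu k i j == a) && (mu l i j == b)) = 1.

(** The columns are x, y, x + y and x - y over the integers modulo m. Any two of them determine x
    and y; for the last two this needs doubling to be injective, which holds for odd m. *)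
Lemma transversal_exists (I : finType) : odd #|I| -> exists mu, transversal (I := I) mu.
Proof.
case En: #|I| => [//|n] odd_n.
have double_inj : injective (fun z : 'I_n.+1 => z + z)%R.
  move=> x y; rewrite -!mulr2n => e.
  (* An odd modulus is one more than twice its half, so z can be recovered from 2z. *)
  have half z : z = (z *+ n.+1 - (z *+ 2) *+ (n.+1)./2)%R :> 'I_n.+1.
    rewrite -mulrnA -mulrnBr; last by lia.
    by rewrite -[LHS]mulr1n; congr (_ *+ _)%R; lia.
  have ord0 (z : 'I_n.+1) : (z *+ n.+1 = 0)%R.
    by apply: val_inj; rewrite Zp_mulrn /= modnMl.
  by rewrite (half x) (half y) e !ord0.
pose nu (k : nat) (p : 'I_n.+1 * 'I_n.+1) : 'I_n.+1 := match k with
  0 => p.1 | 1 => p.2 | 2 => p.1 + p.2 | _ => p.1 - p.2 end%R.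
pose c (i : I) : 'I_n.+1 := cast_ord En (enum_rank i).
have bc : bijective c.
  by exists (fun z => enum_val (cast_ord (esym En) z)) => z;
    rewrite /c ?cast_ordK ?enum_rankK ?enum_valK ?cast_ordKV.
have [c' cK c'K] := bc.
exists (fun k i j => c' (nu k (c i, c j))) => k l a b k4 l4 kl.
pose f (p : I * I) := (c' (nu k (c p.1, c p.2)), c' (nu l (c p.1, c p.2))).
have dbl (x y : 'I_n.+1) : (x + y + (x - y) = x + x)%R by rewrite addrACA subrr addr0.
have nu_inj : injective (fun p => (nu k p, nu l p)).
  move=> [x y] [x' y'] [].
  move: k l k4 l4 kl {f} => [|[|[|[|//]]]] [|[|[|[|//]]]] //= _ _ _.
  - by move=> -> ->.
  - by move=> -> /addrI ->.
  - by move=> -> /addrI /oppr_inj ->.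
  - by move=> -> ->.
  - by move=> -> /addIr ->.
  - by move=> -> /addIr ->.
  - by move=> + e; rewrite e => /addrI ->.
  - by move=> + e; rewrite e => /addIr ->.
  - move=> e1 e2; have ex : x = x' by apply: double_inj; rewrite /= -(dbl x y) e1 e2 dbl.
    by move: e1; rewrite ex => /addrI ->.
  - by move=> + e; rewrite e => /addrI /oppr_inj ->.
  - by move=> + e; rewrite e => /addIr ->.
  - move=> e2 e1; have ex : x = x' by apply: double_inj; rewrite /= -(dbl x y) e1 e2 dbl.
    by move: e1; rewrite ex => /addrI ->.
have f_inj : injective f.
  move=> [i j] [i' j'] []; rewrite /= => /(can_inj c'K) e1 /(can_inj c'K) e2.
  have := nu_inj (c i, c j) (c i', c j'); rewrite e1 e2 => /(_ erefl) e.
  by have /(can_inj cK) -> := congr1 fst e; have /(can_inj cK) -> := congr1 snd e.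
have [f' fK f'K] := injF_bij f_inj.
rewrite pair_big /= (bigD1 (f' (a, b))) //=.
have := f'K (a, b); rewrite /f => - [-> ->]; rewrite !eqxx big1 // => p np.
apply/eqP; rewrite eqb0; apply: contraNN np => /andP [/eqP ea /eqP eb].
by rewrite -(fK p) /f ea eb.
Qed.

(** * Multiplying a frame by a transversal design *)

Section Inflation.

Variables (G : finZmodType) (I : finType) (mu : nat -> I -> I -> I).
Hypothesis muT : transversal mu.

Definition inflate (B : seq (seq (nat * G))) : seq (nat -> G * I * 'I_9) :=
  [seq (fun k => ((nth (0, 0%R) q k).2 + p.1, mu k p.2.1 p.2.2,
                  inord (nth (0, 0%R) q k).1)%R)
    | p <- enum {: G * (I * I)}, q <- B].

Definition proper_slots (S : seq (nat * nat)) :=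
  all (fun s => [&& s.1 < 4, s.2 < 4 & s.1 != s.2]) S.

(** The first coordinates fix the translate as in the method of differences; the second ones then
    fix exactly one row of the transversal design. The count is therefore independent of i and j. *)
Lemma covers_inflate S B x i (a : 'I_9) y j (b : 'I_9) :
  proper_slots S -> valid_colours 9 B ->
  covers S (inflate B) (x, i, a) (y, j, b) = count_mem (y - x)%R (diffs S B a b).
Proof.
move=> /allP pS vB; rewrite /covers /inflate big_allpairs_dep big_enum /= count_diffs exchange_big /=.
apply: eq_sum_valid vB _ => q vq; rewrite exchange_big /=; apply: eq_big_seq => s /pS /and3P [s1 s2 s12].
have := nth_colour s.1 vq; have := nth_colour s.2 vq.
move: (nth _ _ s.1) (nth _ _ s.2) => u v v9 u9.
rewrite -(pair_bigA _ (fun g p => (((u.2 + g, mu s.1 p.1 p.2, inord u.1) == (x, i, a)) &&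
  ((v.2 + g, mu s.2 p.1 p.2, inord v.1) == (y, j, b)) : nat)%R)) /=.
rewrite (bigD1 (x - u.2)%R) //= [X in _ + X]big1 => [|g ng]; last first.
  apply: big1 => p _; rewrite !xpair_eqE.
  have -> : (u.2 + g == x)%R = false by rewrite addrC -(inj_eq (addIr (- u.2)%R)) addrK; apply: negPf.
  by [].
rewrite addn0; under eq_bigr do rewrite !xpair_eqE subrKC eqxx.
rewrite -[RHS]muln1 -[X in _ = _ * X](muT i j s1 s2 s12) pair_bigA big_distrr /=.
apply: eq_bigr => p _; rewrite mulnb; congr nat_of_bool.
have inE9 k (c : 'I_9) : k < 9 -> (inord k == c) = (k == c) by move=> k9; rewrite -val_eqE /= inordK.
rewrite !inE9 //; have -> : (v.2 + (x - u.2) == y)%R = (v.2 - u.2 == y - x)%R.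
  rewrite -subr_eq0 -[RHS]subr_eq0; congr (_ == _).
  by rewrite !opprB addrCA addrC !addrA; rewrite addrAC.
by do !case: (_ == _).
Qed.

Definition fill (g : G) (x : point I) : point (G * I) :=
  match x with inl (i, c) => inl (g, i, c) | inr h => inr h end.

Definition inflate_fill B (L : seq (nat -> point I)) : seq (nat -> point (G * I)) :=
  [seq (fun k => inl (q k)) | q <- inflate B] ++ [seq (fun k => fill g (q k)) | g <- enum G, q <- L].

Lemma covers_inflate_fill S B L X Y :
  covers S (inflate_fill B L) X Y =
  (if (X, Y) is (inl u, inl v) then covers S (inflate B) u v else 0) +
  \sum_g \sum_(q <- L) \sum_(s <- S) ((fill g (q s.1) == X) && (fill g (q s.2) == Y)).
Proof.
rewrite /covers /inflate_fill big_cat big_map /=; congr (_ + _); last by rewrite big_allpairs_dep big_enum.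
by case: X Y => [u|h] [v|h'] /=; [exact: eq_bigr | | |];
  apply: big1 => q _; apply: big1 => s _; rewrite ?andbF.
Qed.

Lemma fill_eq_inl g u x i c :
  (fill g u == inl (x, i, c)) = (g == x) && (u == inl (i, c)).
Proof.
case: u => [[j d]|h] /=; last by rewrite andbF.
by rewrite [LHS]/eq_op /= [inl _ == _]/eq_op /= !xpair_eqE andbA.
Qed.

Lemma fill_eq_inr g u h : (fill g u == inr h) = (u == inr h).
Proof. by case: u => [[j d]|h']. Qed.

(** Pairs between different elements of [G] come from the inflated frame alone, pairs over the same
    element from one copy of [L] alone. The copies meet only in the hole, where [L] covers
    nothing. *)
Lemma inflate_fill_incomplete B L :
  incomplete L -> valid_colours 9 B ->
  (forall (a b : 'I_9) z, count_mem z (diffs tri B a b) = 2 * [&& a < 6, b < 6 & z != 0%R]) ->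
  (forall (a b : 'I_9) z, count_mem z (diffs star B a b) <= (z != 0%R)) ->
  incomplete (inflate_fill B L).
Proof.
move=> [triL starL] vB triB starB.
have fill_inl S x i a Y :
  \sum_g \sum_(q <- L) \sum_(s <- S) ((fill g (q s.1) == inl (x, i, a)) && (fill g (q s.2) == Y)) =
  \sum_(q <- L) \sum_(s <- S) ((q s.1 == inl (i, a)) && (fill x (q s.2) == Y)).
  rewrite (bigD1 x) //= [X in _ + X]big1 ?addn0.
    by apply: eq_bigr => q _; apply: eq_bigr => s _; rewrite fill_eq_inl eqxx.
  by move=> g /negPf ng; apply: big1 => q _; apply: big1 => s _; rewrite fill_eq_inl ng.
have ll S x i a y j b : proper_slots S ->
    covers S (inflate_fill B L) (inl (x, i, a)) (inl (y, j, b)) =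
    count_mem (y - x)%R (diffs S B a b) + (x == y) * covers S L (inl (i, a)) (inl (j, b)).
  move=> pS; rewrite covers_inflate_fill covers_inflate // fill_inl.
  congr (_ + _); case: eqP => [->|/eqP/negPf nxy]; rewrite ?mul1n ?mul0n.
    by apply: eq_bigr => q _; apply: eq_bigr => s _; rewrite fill_eq_inl eqxx.
  by apply: big1 => q _; apply: big1 => s _; rewrite fill_eq_inl nxy andbF.
have lr S x i a h :
    covers S (inflate_fill B L) (inl (x, i, a)) (inr h) = covers S L (inl (i, a)) (inr h).
  rewrite covers_inflate_fill fill_inl add0n.
  by apply: eq_bigr => q _; apply: eq_bigr => s _; rewrite fill_eq_inr.
have rr S h h' :
    covers S (inflate_fill B L) (inr h) (inr h') = #|G| * covers S L (inr h) (inr h').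
  rewrite covers_inflate_fill add0n -sum_nat_const.
  apply: eq_bigr => g _; apply: eq_bigr => q _; apply: eq_bigr => s _.
  by rewrite !fill_eq_inr.
have sub0 (x y : G) : (y - x != 0)%R = (x != y) by rewrite subr_eq0 eq_sym.
split; case=> [[[x i] a]|h]; case=> [[[y j] b]|h'].
- rewrite ll // triB triL sub0 /= !andbT.
  rewrite ![inl _ == _]/eq_op /= !xpair_eqE.
  by case: (x == y); case: (i == j); case: (a == b); case: (a < 6); case: (b < 6).
- by rewrite lr triL.
- by rewrite coversC ?triC // lr triL /= !andbT andbC.
- by rewrite rr triL !andbF !muln0.
- rewrite ll // andbT; have := starB a b (y - x)%R; rewrite sub0.
  have := starL (inl (i, a)) (inl (j, b)); rewrite andbT.
  rewrite ![inl _ == _]/eq_op /= !xpair_eqE.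
  case: (x == y) => /=; last by rewrite mul0n addn0.
  by rewrite mul1n leqn0 => h /eqP ->.
- by rewrite lr; apply: starL.
- by rewrite coversC ?starC // lr; apply: starL.
- have := starL (inr h) (inr h'); rewrite rr !andbF !leqn0 => /eqP ->.
  by rewrite muln0.
Qed.

End Inflation.

(** * Base blocks *)

(* The base blocks below, found by a computer search, are closed under this permutation
   of order 3: [fixed_] lists the blocks it fixes, [orbits_] one block per longer orbit. *)
Definition rotate_colour (s c : nat) : nat :=
  if c < 9 then c %/ 3 * 3 + (c + s) %% 3
  else if c < 13 then c else 13 + (c - 13 + s) %% 3.

Definition colour_orbits (B : seq (seq (nat * nat))) : seq (seq (nat * nat)) :=
  [seq [seq (rotate_colour s cp.1, cp.2) | cp <- q] | s <- iota 0 3, q <- B].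

Definition relabel (P G : Type) (f : P -> G) (B : seq (seq (nat * P))) : seq (seq (nat * G)) :=
  [seq [seq (cp.1, f cp.2) | cp <- q] | q <- B].

Definition fixed_three : seq (seq (nat * nat)) := [::
  [:: (10, 0); (0, 0); (1, 0); (2, 0)];
  [:: (9, 0); (3, 0); (4, 0); (5, 0)]].

Definition orbits_three : seq (seq (nat * nat)) := [::
  [:: (7, 1); (3, 0); (3, 1); (5, 2)];
  [:: (8, 0); (3, 0); (4, 1); (10, 0)];
  [:: (5, 2); (0, 0); (3, 0); (3, 2)];
  [:: (2, 1); (0, 0); (3, 0); (5, 1)];
  [:: (6, 2); (0, 0); (3, 1); (11, 0)];
  [:: (4, 1); (0, 0); (5, 0); (11, 0)];
  [:: (1, 0); (0, 0); (4, 2); (9, 0)];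
  [:: (8, 2); (0, 0); (5, 2); (9, 0)];
  [:: (7, 1); (0, 0); (5, 0); (12, 0)];
  [:: (13, 0); (0, 0); (3, 1); (4, 1)];
  [:: (0, 2); (0, 0); (2, 1); (4, 2)];
  [:: (5, 1); (0, 0); (5, 2); (12, 0)];
  [:: (15, 0); (0, 0); (4, 0); (1, 1)];
  [:: (7, 2); (0, 0); (4, 0); (0, 2)];
  [:: (3, 1); (0, 0); (1, 1); (10, 0)];
  [:: (6, 0); (0, 0); (1, 0); (1, 2)]].

Definition fixed_nine : seq (seq (nat * nat)) := [::
  [:: (12, 0); (0, 0); (1, 0); (2, 0)];
  [:: (10, 0); (3, 0); (4, 0); (5, 0)]].

Definition orbits_nine : seq (seq (nat * nat)) := [::
  [:: (2, 8); (0, 0); (1, 1); (0, 4)];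
  [:: (13, 0); (0, 0); (3, 5); (5, 8)];
  [:: (5, 3); (0, 0); (3, 1); (3, 8)];
  [:: (8, 0); (0, 0); (5, 0); (5, 6)];
  [:: (7, 1); (0, 0); (4, 0); (11, 0)];
  [:: (7, 6); (0, 0); (5, 2); (5, 4)];
  [:: (7, 7); (0, 0); (3, 2); (10, 0)];
  [:: (2, 5); (3, 0); (3, 3); (4, 6)];
  [:: (8, 2); (0, 0); (1, 2); (5, 6)];
  [:: (1, 3); (0, 0); (3, 1); (2, 2)];
  [:: (3, 6); (0, 0); (2, 4); (12, 0)];
  [:: (2, 3); (0, 0); (5, 4); (10, 0)];
  [:: (6, 4); (0, 0); (2, 1); (3, 2)];
  [:: (8, 8); (0, 0); (5, 0); (0, 2)];
  [:: (5, 6); (0, 0); (3, 0); (3, 8)];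
  [:: (6, 7); (3, 0); (5, 4); (12, 0)];
  [:: (4, 0); (0, 0); (2, 1); (4, 2)];
  [:: (7, 1); (3, 0); (5, 1); (5, 5)];
  [:: (4, 3); (0, 0); (3, 6); (5, 7)];
  [:: (0, 3); (0, 0); (3, 3); (5, 5)];
  [:: (14, 0); (0, 0); (5, 2); (2, 5)];
  [:: (6, 5); (0, 0); (0, 3); (4, 6)];
  [:: (6, 6); (3, 0); (4, 0); (5, 4)];
  [:: (7, 2); (0, 0); (3, 5); (4, 7)];
  [:: (6, 0); (0, 0); (5, 1); (5, 5)];
  [:: (6, 8); (0, 0); (4, 1); (1, 7)];
  [:: (0, 2); (0, 0); (3, 7); (4, 8)];
  [:: (6, 1); (0, 0); (4, 0); (2, 6)];
  [:: (5, 0); (0, 0); (5, 3); (2, 5)];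
  [:: (4, 8); (0, 0); (3, 0); (1, 1)];
  [:: (8, 4); (0, 0); (0, 1); (4, 6)];
  [:: (8, 7); (0, 0); (0, 2); (4, 7)];
  [:: (0, 5); (0, 0); (1, 0); (2, 3)];
  [:: (6, 7); (0, 0); (0, 1); (4, 4)];
  [:: (1, 0); (0, 0); (4, 2); (3, 4)];
  [:: (7, 5); (0, 0); (1, 2); (0, 6)];
  [:: (4, 5); (0, 0); (0, 4); (9, 0)];
  [:: (0, 1); (0, 0); (3, 4); (11, 0)];
  [:: (1, 4); (3, 0); (4, 3); (9, 0)];
  [:: (5, 0); (3, 0); (3, 1); (5, 8)]].

Definition fixed_special : seq (seq (nat * nat)) := [::
  [:: (12, 0); (0, 0); (1, 0); (2, 0)];
  [:: (11, 0); (3, 0); (4, 0); (5, 0)]].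

Definition orbits_special : seq (seq (nat * nat)) := [::
  [:: (4, 0); (3, 1); (4, 2); (10, 0)];
  [:: (8, 1); (3, 0); (3, 2); (0, 3)];
  [:: (2, 0); (0, 0); (3, 0); (5, 0)];
  [:: (4, 1); (3, 0); (2, 3); (12, 0)];
  [:: (8, 0); (0, 0); (4, 0); (12, 0)];
  [:: (5, 0); (0, 0); (3, 0); (9, 0)];
  [:: (6, 2); (3, 0); (3, 2); (5, 3)];
  [:: (7, 1); (0, 0); (0, 2); (4, 3)];
  [:: (13, 0); (0, 0); (1, 1); (3, 3)];
  [:: (2, 1); (0, 0); (0, 2); (5, 2)];
  [:: (5, 2); (0, 0); (1, 3); (2, 3)];
  [:: (6, 0); (0, 0); (4, 0); (11, 0)];
  [:: (15, 0); (3, 0); (1, 2); (4, 3)];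
  [:: (2, 0); (3, 1); (2, 2); (11, 0)];
  [:: (7, 1); (3, 0); (1, 2); (9, 0)];
  [:: (6, 1); (0, 0); (2, 1); (10, 0)]].

Definition orbits_prime : seq (seq (nat * nat)) := [::
  [:: (7, 1); (5, 2); (5, 0); (4, 3)];
  [:: (8, 2); (4, 1); (4, 3); (0, 0)];
  [:: (7, 2); (1, 1); (1, 3); (4, 0)];
  [:: (7, 1); (0, 2); (0, 0); (2, 3)];
  [:: (5, 2); (3, 1); (0, 0); (1, 3)];
  [:: (1, 2); (3, 0); (4, 1); (2, 3)];
  [:: (3, 2); (2, 1); (3, 0); (4, 3)];
  [:: (1, 2); (2, 1); (1, 0); (4, 3)]].

Definition orbits_gf9 : seq (seq (nat * nat)) := [::
  [:: (1, 0); (4, 1); (4, 2); (5, 6)];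
  [:: (4, 0); (2, 7); (2, 5); (4, 6)];
  [:: (0, 0); (2, 2); (2, 1); (0, 3)];
  [:: (3, 0); (4, 7); (4, 5); (2, 6)];
  [:: (7, 0); (3, 4); (2, 6); (0, 5)];
  [:: (6, 0); (5, 8); (4, 4); (1, 3)];
  [:: (7, 0); (1, 5); (0, 7); (4, 6)];
  [:: (8, 0); (3, 8); (2, 7); (5, 3)]].

Definition blocks_ten : seq (seq nat) := [::
  [:: 11; 7; 6; 3];
  [:: 13; 6; 7; 0];
  [:: 5; 8; 0; 4];
  [:: 10; 3; 9; 4];
  [:: 14; 4; 0; 7];
  [:: 10; 8; 7; 2];
  [:: 4; 2; 7; 9];
  [:: 0; 8; 6; 3];
  [:: 3; 4; 6; 5];
  [:: 15; 8; 9; 6];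
  [:: 12; 0; 3; 8];
  [:: 9; 0; 2; 3];
  [:: 1; 8; 5; 7];
  [:: 13; 9; 3; 4];
  [:: 8; 6; 2; 9];
  [:: 14; 8; 9; 1];
  [:: 2; 5; 1; 3];
  [:: 15; 7; 1; 3];
  [:: 0; 2; 4; 1];
  [:: 12; 4; 2; 6];
  [:: 7; 9; 0; 5];
  [:: 14; 2; 5; 3];
  [:: 11; 0; 9; 1];
  [:: 9; 1; 5; 6];
  [:: 10; 6; 1; 0];
  [:: 15; 0; 2; 5];
  [:: 12; 9; 5; 7];
  [:: 11; 5; 4; 8];
  [:: 6; 7; 1; 4];
  [:: 13; 8; 2; 1]].

(** * Verification by computation, and the cases of 3 and 9 groups *)

Definition develop_check (G : finZmodType) (zs : seq G) (B : seq (seq (nat * G))) :=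
  all (fun a => all (fun b => all (fun z =>
    (count_mem z (diffs tri B a b) == 2 * [&& a < 6, b < 6 & ~~ ((z == 0%R) && (a == b))]) &&
    (count_mem z (diffs star B a b) <= ~~ ((z == 0%R) && (a == b)))) zs) (iota 0 9)) (iota 0 9).

Lemma develop_checkP (G : finZmodType) (zs : seq G) B : zs =i G ->
  hole_check B -> develop_check zs B -> incomplete (develop B).
Proof.
move=> zsG hB /allP cB; have main (a b : 'I_9) z := allP (allP (cB _ (ord_iota a)) _ (ord_iota b)) z.
apply: develop_incomplete => // a b z; have := main a b z; rewrite zsG => /(_ isT) /andP [].
  by move=> /eqP.
by [].
Qed.

(** An explicit list, so that the checks evaluate by computation. *)
Definition residues n : seq 'I_n.+1 := [seq inZp i | i <- iota 0 n.+1].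

Lemma mem_residues n : residues n =i 'I_n.+1.
Proof.
move=> z; suff -> : z \in residues n by [].
by apply/mapP; exists (z : nat); rewrite ?mem_iota ?ltn_ord ?valZpK.
Qed.

Definition base_three := relabel (@inZp 2) (fixed_three ++ colour_orbits orbits_three).
Definition base_nine := relabel (@inZp 8) (fixed_nine ++ colour_orbits orbits_nine).

Lemma incomplete_three : exists L, incomplete (I := 'I_3) L.
Proof.
exists (develop base_three); apply: (develop_checkP (@mem_residues 2)); by vm_compute.
Qed.

Lemma incomplete_nine : exists L, incomplete (I := 'I_9) L.
Proof.
exists (develop base_nine); apply: (develop_checkP (@mem_residues 8)); by vm_compute.
Qed.

(** * Frames *)

Definition frame_check (G : finZmodType) (zs : seq G) (B : seq (seq (nat * G))) :=
  all (fun a => all (fun b => all (fun z =>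
    (count_mem z (diffs tri B a b) == 2 * [&& a < 6, b < 6 & z != 0%R]) &&
    (count_mem z (diffs star B a b) <= (z != 0%R))) zs) (iota 0 9)) (iota 0 9).

HB.instance Definition _ (G1 G2 : finZmodType) := GRing.Zmodule.on (G1 * G2)%type.

(* With a + b i in F_9 = F_3[i] at position 3 a + b, this is the multiplication by the
   generator 1 + i, whose first four powers represent F_9^* up to sign. *)
Definition mul_gf9 (z : 'I_3 * 'I_3) : 'I_3 * 'I_3 := (z.1 - z.2, z.1 + z.2)%R.

Definition base_gf9 : seq (seq (nat * ('I_3 * 'I_3))) :=
  flatten [seq relabel (fun i => iter k mul_gf9 (inZp (i %/ 3), inZp i)) (colour_orbits orbits_gf9)
    | k <- iota 0 4].

Definition all_gf9 : seq ('I_3 * 'I_3) := [seq (x, y) | x <- residues 2, y <- residues 2].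

Lemma gf9_frame_check : valid_colours 9 base_gf9 && frame_check all_gf9 base_gf9.
Proof. by vm_compute. Qed.

(** In contrast to a design with a hole, the difference 0 is excluded for all pairs of colours:
    pairs inside a group are left to the filling. *)
Definition frame (G : finZmodType) (B : seq (seq (nat * G))) : Prop :=
  [/\ valid_colours 9 B,
   forall (a b : 'I_9) z, count_mem z (diffs tri B a b) = 2 * [&& a < 6, b < 6 & z != 0%R] &
   forall (a b : 'I_9) z, count_mem z (diffs star B a b) <= (z != 0%R)].

(** Transfers difference lists computed over the integers to the prime fields, with [h] a scaled
    reduction modulo p. The conditions at 0 keep the default position of [nth] consistent. *)
Lemma count_relabel (G G' : zmodType) (h : G -> G') (f : nat -> G) (f' : nat -> G') S
    (B : seq (seq (nat * nat))) a b P :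
  f 0 = 0%R -> f' 0 = 0%R -> (forall i j, f' j - f' i = h (f j - f i))%R ->
  count P (diffs S (relabel f' B) a b) = count (P \o h) (diffs S (relabel f B) a b).
Proof.
move=> f0 f'0 fh; rewrite !count_diffs !big_map; apply: eq_bigr => q _; apply: eq_bigr => s _.
have nthE (H : zmodType) (g : nat -> H) k : g 0 = 0%R ->
    nth (0, 0%R) [seq (cp.1, g cp.2) | cp <- q] k = ((nth (0, 0) q k).1, g (nth (0, 0) q k).2).
  move=> g0; case: (ltnP k (size q)) => hk; first by rewrite (nth_map (0, 0)).
  by rewrite !nth_default ?size_map // g0.
by rewrite !nthE //= fh.
Qed.

(** Inclusion of multisets need only be tested on the entries of [s1], a finite check; [s1] is then
    a rearrangement of a subsequence of [s2]. *)
Lemma count_le_of_count_mem (T : eqType) (s1 s2 : seq T) (P : pred T) :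
  all (fun x => count_mem x s1 <= count_mem x s2) s1 -> count P s1 <= count P s2.
Proof.
move=> /allP h; have : forall x, count_mem x s1 <= count_mem x s2.
  by move=> x; case: (boolP (x \in s1)) => [/h //|/count_memPn ->].
by move/count_subseqP => [s sub /permP ->]; apply: leq_count_subseq.
Qed.

Lemma diffs_cat (G : zmodType) S (B1 B2 : seq (seq (nat * G))) a b :
  diffs S (B1 ++ B2) a b = diffs S B1 a b ++ diffs S B2 a b.
Proof. by rewrite /diffs map_cat flatten_cat. Qed.

Lemma diffs_large_colour (G : zmodType) S (B : seq (seq (nat * G))) a b :
  valid_colours 9 B -> 9 <= b -> diffs S B a b = [::].
Proof.
move=> vB b9; apply: size0nil; rewrite size_diffs.
rewrite (eq_sum_valid (F2 := fun=> 0) vB) ?big1 // => q vq; apply: big1 => s _.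
by rewrite [X in _ && X]ltn_eqF ?andbF // (leq_trans _ b9) // nth_colour.
Qed.

Definition int_diffs S (B : seq (seq (nat * nat))) a b : seq int := diffs S (relabel Posz B) a b.

Definition base_prime := colour_orbits orbits_prime.

(* Replaces [base_prime] for d = 1: the nonzero differences are the same in the blocks
   and among the same ones in the nesting pairs. *)
Definition base_special := fixed_special ++ colour_orbits orbits_special.

(** The positions in the base blocks run from 0 to 3, so these are the possible nonzero differences;
    all remain invertible modulo a prime p >= 5. *)
Definition small_differences : seq int := [:: 1; 2; 3; -1; -2; -3]%R.

(** The sizes 4 and 2 are twice what a frame requires: only one of d and - d is used as a
    multiplier, which halves the number of times each nonzero element occurs. *)
Lemma base_prime_check :
  all (fun a => all (fun b =>
    let t := int_diffs tri base_prime a b in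
    let s := int_diffs star base_prime a b in
    [&& perm_eq [seq (- d)%R | d <- t] t, perm_eq [seq (- d)%R | d <- s] s,
        all (mem small_differences) t, all (mem small_differences) s,
        size t == 4 * ((a < 6) && (b < 6)) & size s <= 2]) (iota 0 9)) (iota 0 9).
Proof. by vm_compute. Qed.

(** The added zeros are the pairs inside a group: two for each pair of distinct inner colours in the
    blocks, at most one for distinct colours in the nesting pairs. *)
Lemma base_special_check :
  all (fun a => all (fun b =>
    let t := int_diffs tri base_special a b in
    let s := int_diffs star base_special a b in
    perm_eq t (int_diffs tri base_prime a b ++ nseq (2 * [&& a < 6, b < 6 & a != b]) 0%R) &&
    all (fun d => count_mem d s <= count_mem d (int_diffs star base_prime a b ++ nseq (a != b) 0%R)) s)
   (iota 0 9)) (iota 0 9).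
Proof. by vm_compute. Qed.

(* By [hole_check_relabel] the group, here 'I_5, plays no role. *)
Lemma hole_check_special : hole_check (relabel (fun i => inZp i : 'I_5) base_special).
Proof. by vm_compute. Qed.

Lemma base_prime_valid : valid_colours 9 (relabel Posz base_prime).
Proof. by vm_compute. Qed.

Lemma nth_relabel_colour (P : Type) (G : zmodType) (x : P) (f : P -> G) (q : seq (nat * P)) k :
  (nth (0, 0%R) [seq (cp.1, f cp.2) | cp <- q] k).1 = (nth (0, x) q k).1.
Proof.
case: (ltnP k (size q)) => hk; first by rewrite (nth_map (0, x)).
by rewrite !nth_default ?size_map.
Qed.

Lemma size_diffs_relabel (G G' : zmodType) (f : nat -> G) (f' : nat -> G') S B a b :
  size (diffs S (relabel f B) a b) = size (diffs S (relabel f' B) a b).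
Proof.
rewrite !size_diffs !big_map; apply: eq_bigr => q _; apply: eq_bigr => s _.
by rewrite !(nth_relabel_colour 0).
Qed.

Lemma valid_relabel (G G' : zmodType) (f : nat -> G) (f' : nat -> G') n B :
  valid_colours n (relabel f B) = valid_colours n (relabel f' B).
Proof. by rewrite /valid_colours !all_map; apply: eq_all => q /=; rewrite !all_map. Qed.

Lemma hole_check_relabel (G G' : finZmodType) (f : nat -> G) (f' : nat -> G') B :
  hole_check (relabel f B) = hole_check (relabel f' B).
Proof.
rewrite /hole_check (valid_relabel f f'); congr [&& _, _ & _].
  apply: eq_all => a; apply: eq_all => h; by rewrite !(size_diffs_relabel f f').
apply: eq_all => h; apply: eq_all => h'; by rewrite /nilp !(size_diffs_relabel f f').
Qed.

Lemma hole_check_cat (G : finZmodType) (B1 B2 : seq (seq (nat * G))) :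
  valid_colours 9 B1 -> hole_check B2 -> hole_check (B1 ++ B2).
Proof.
move=> v1 /and3P [v2 /allP h1 /allP h2]; apply/and3P; split.
- rewrite /valid_colours all_cat; apply/andP; split=> //; apply: sub_all v1 => q.
  by apply: sub_all => cp /= h; apply: leq_trans h _.
- apply/allP => a a9; apply/allP => h h7; have h9 : 9 <= h by move: h7; rewrite mem_iota => /andP [].
  by rewrite !diffs_cat !(diffs_large_colour _ _ v1 h9); exact: (allP (h1 a a9)).
- apply/allP => h h7; apply/allP => h' h7'; have h9 : 9 <= h' by move: h7'; rewrite mem_iota => /andP [].
  by rewrite !diffs_cat !(diffs_large_colour _ _ v1 h9); exact: (allP (h2 h h7)).
Qed.

(** * The case of a prime number of groups *)

Section Prime.

Variable p : nat.
Hypotheses (p_pr : prime p) (p_ge5 : 4 < p).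

Lemma small_unit d : d \in small_differences -> (d%:~R != 0 :> 'F_p)%R.
Proof.
have natp k : 0 < k < 4 -> (k%:R != 0 :> 'F_p)%R.
  move=> k4; rewrite -(dvdn_pcharf (pchar_Fp p_pr)); apply/negP => /dvdn_leq; lia.
rewrite !inE => /or4P [/eqP ->|/eqP ->|/eqP ->|/or3P [] /eqP ->];
  rewrite ?mulrNz ?oppr_eq0; exact: natp.
Qed.

(* Contains exactly one of z, - z for z nonzero, and contains 1. *)
Definition half : pred 'F_p := fun z => (z : nat) < (- z)%R.

Lemma halfN z : z != 0%R -> half z + half (- z)%R = 1.
Proof.
move=> z0; rewrite /half opprK; have : z != (- z)%R.
  rewrite -subr_eq0 opprK -mulr2n -mulr_natr mulf_neq0 //.
  exact: (small_unit (d := Posz 2)).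
by rewrite -val_eqE /=; case: ltngtP.
Qed.

Lemma half0 : half 0%R = false.
Proof. by rewrite /half oppr0 ltnn. Qed.

Lemma half1 : half 1%R.
Proof.
rewrite /half (_ : (1%R : 'F_p) = 1 :> nat) // ltn_neqAle lt0n.
have n1 : ((- 1 : 'F_p) != 0)%R by rewrite oppr_eq0 oner_neq0.
rewrite -val_eqE /= in n1; rewrite n1 andbT; apply/negP => /eqP e.
have := small_unit (d := Posz 2) isT; rewrite (_ : (2%:~R : 'F_p) = 1 - (- 1))%R.
  have E1 : (1 = - 1 :> 'F_p)%R := ord_inj (e : nat_of_ord (1%R : 'F_p) = nat_of_ord (- 1 : 'F_p)%R).
  by rewrite -E1 subrr eqxx.
by rewrite opprK.
Qed.

Definition scaled_base (ds : seq 'F_p) : seq (seq (nat * 'F_p)) :=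
  flatten [seq relabel (fun i => d * i%:R)%R base_prime | d <- ds].

Lemma scaled_base_valid ds : valid_colours 9 (scaled_base ds).
Proof.
apply/allP => q /flattenP [B /mapP [d _ ->]]; apply/allP.
by have := base_prime_valid; rewrite (valid_relabel _ (fun i => d * i%:R)%R).
Qed.

Lemma count_scaled_base S ds a b z :
  count_mem z (diffs S (scaled_base ds) a b) =
  \sum_(d <- ds) count (fun k => d * k%:~R == z)%R (int_diffs S base_prime a b).
Proof.
elim: ds => [|d ds IH]; first by rewrite big_nil /diffs.
rewrite big_cons -IH -[scaled_base (d :: ds)]/(relabel (fun i => d * i%:R)%R base_prime ++ scaled_base ds).
rewrite diffs_cat count_cat; congr (_ + _).
apply: (count_relabel (h := fun k : int => d * k%:~R)%R) => //; first by rewrite mulr0.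
by move=> i j; rewrite -mulrBr rmorphB.
Qed.

(* Since s = - s, twice the sum counts the d in [half] with d k = z or d k = - z, for each
   k in s; there is one if z is nonzero. *)
Lemma count_half_multiples (s : seq int) (z : 'F_p) :
  perm_eq [seq (- d)%R | d <- s] s -> all (mem small_differences) s ->
  2 * \sum_(d <- enum half) count (fun k => d * k%:~R == z)%R s = size s * (z != 0%R).
Proof.
move=> sN /allP small.
(* As k is invertible, the only multiplier taking it to w is w / k. *)
have E (w : 'F_p) : \sum_(d <- enum half) count (fun k => d * k%:~R == w)%R s =
    \sum_(k <- s) half (w / k%:~R)%R.
  under eq_bigr do rewrite -sum1_count big_mkcond.
  rewrite exchange_big /=; apply: eq_big_seq => k /small /small_unit ku.
  rewrite big_enum big_mkcond (bigD1 (w / k%:~R)%R) // divfK // eqxx big1 => [|d nd].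
    by rewrite [LHS]addn0 -[_ \in half]/(half _); case: (half _).
  case: ifP => // _; case: eqP => // e.
  by rewrite -e mulfK // eqxx in nd.
rewrite mul2n -addnn {1}E.
have -> : \sum_(d <- enum half) count (fun k => d * k%:~R == z)%R s =
  \sum_(k <- s) half (- (z / k%:~R))%R.
  rewrite E -[LHS](perm_big _ sN) big_map; apply: eq_bigr => k _.
  by rewrite mulrNz invrN mulrN.
rewrite -big_split (eq_big_seq (fun=> (z != 0%R) : nat)) => [|k /small /small_unit ku] /=.
  by rewrite big_const_seq count_predT iter_addn_0 mulnC.
by case: eqP => [->|/eqP z0] /=; rewrite ?mul0r ?oppr0 ?half0 // halfN // mulf_neq0 ?invr_neq0.
Qed.



Lemma frame_prime : frame (scaled_base (enum half)).
Proof.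
split=> [|a b z|a b z]; first exact: scaled_base_valid.
  have /and5P [tN _ tsmall _ /andP [/eqP tsize _]] := allP (allP base_prime_check _ (ord_iota a)) _ (ord_iota b).
  rewrite count_scaled_base; have := count_half_multiples z tN tsmall; rewrite tsize.
  by move: (\sum_(_ <- _) _) => n; case: (a < 6); case: (b < 6); case: (z != 0%R) => /=; lia.
have /and5P [_ sN _ ssmall /andP [_ ssize]] := allP (allP base_prime_check _ (ord_iota a)) _ (ord_iota b).
rewrite count_scaled_base; have := count_half_multiples z sN ssmall.
by move: (\sum_(_ <- _) _) ssize => n; case: (z != 0%R) => /=; lia.
Qed.

Lemma incomplete_prime : exists L, incomplete (I := 'F_p) L.
Proof.
(* The multiplier 1 is dropped, and the special blocks take the place of its base blocks. *)
pose ds := rem 1%R (enum half); pose B := scaled_base ds ++ relabel (fun i => i%:R : 'F_p)%R base_special.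
have [_ frame_tri frame_star] := frame_prime.
have mem1 : (1%R : 'F_p) \in enum half by rewrite mem_enum; exact: half1.
have split1 S a b z : count_mem z (diffs S (scaled_base (enum half)) a b) =
    count (fun k => k%:~R == z)%R (int_diffs S base_prime a b) +
    count_mem z (diffs S (scaled_base ds) a b).
  rewrite !count_scaled_base (perm_big _ (perm_to_rem mem1)) big_cons.
  by congr (_ + _); apply: eq_count => k; rewrite mul1r.
have countB sl a b z : count_mem z (diffs sl B a b) = count_mem z (diffs sl (scaled_base ds) a b) +
    count (fun k => k%:~R == z)%R (int_diffs sl base_special a b).
  rewrite diffs_cat count_cat; congr (_ + _).
  apply: (count_relabel (h := fun k : int => k%:~R)%R) => // i j; by rewrite rmorphB.
have eq0z (z : 'F_p) : (0%:~R == z)%R = (z == 0%R) by rewrite eq_sym.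
exists (develop B); apply: develop_incomplete => [|a b z|a b z].
- apply: hole_check_cat; first exact: scaled_base_valid.
  by rewrite (hole_check_relabel _ (fun i => inZp i : 'I_5)) hole_check_special.
- have /andP [/permP tB _] := allP (allP base_special_check _ (ord_iota a)) _ (ord_iota b).
  rewrite countB tB count_cat count_nseq addnA (addnC _ (count _ (int_diffs _ _ _ _))) -split1 frame_tri.
  rewrite /= eq0z -[(a : nat) == b]/(a == b).
  by case: (a < 6); case: (b < 6); case: (z == 0%R); case: (a == b).
- have /andP [_ sB] := allP (allP base_special_check _ (ord_iota a)) _ (ord_iota b).
  have special_le : count (fun k => k%:~R == z)%R (int_diffs star base_special a b) <=
      count (fun k => k%:~R == z)%R (int_diffs star base_prime a b) + (0%:~R == z)%R * (a != b).
    by rewrite -(count_nseq (fun k => k%:~R == z)%R) -count_cat; exact: count_le_of_count_mem sB.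
  move: special_le (frame_star a b z); rewrite countB split1 eq0z.
  move: (count _ (int_diffs star base_special a b)) (count _ (int_diffs star base_prime a b)).
  move: (count_mem z _) => n1 n2 n3.
  (* For z = 0 the frame contributes nothing, which leaves the added zero for distinct colours; for
     other z the bound of the frame applies. *)
  by case: (z == 0%R); case: (a == b) => /=; lia.
Qed.

End Prime.

(** * Filling the hole, and induction on the number of groups *)

(** A form of the count that evaluates by computation. *)
Lemma covers_sumn (T : eqType) S (L : seq (nat -> T)) x y :
  covers S L x y = sumn [seq count (fun s => (q s.1 == x) && (q s.2 == y)) S | q <- L].
Proof.
rewrite sumnE big_map; apply: eq_bigr => q _.
by rewrite /cover -sum1_count [RHS]big_mkcond.
Qed.

Definition quads_of n (L : seq (seq nat)) : seq (nat -> 'I_n.+1) :=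
  [seq (fun k => inZp (nth 0 q k)) | q <- L].

Lemma all_residues n (P : 'I_n.+1 -> 'I_n.+1 -> bool) :
  all (fun x => all (P x) (residues n)) (residues n) -> forall x y, P x y.
Proof.
by move=> /allP h x y; apply: (allP (h x _)); rewrite mem_residues.
Qed.

Definition design_check n v (L : seq (seq nat)) :=
  all (fun x : 'I_n.+1 => all (fun y =>
    (sumn [seq count (fun s => (q s.1 == x) && (q s.2 == y)) tri | q <- quads_of n L]
      == 2 * [&& x != y, x < v & y < v]) &&
    (sumn [seq count (fun s => (q s.1 == x) && (q s.2 == y)) star | q <- quads_of n L]
      <= (x != y))) (residues n)) (residues n).

Lemma design_checkP n v L : design_check n v L -> forall x y,
  covers tri (quads_of n L) x y = 2 * [&& x != y, x < v & y < v] /\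
  covers star (quads_of n L) x y <= (x != y).
Proof.
by move=> /all_residues h x y; rewrite !covers_sumn; have /andP [/eqP -> ->] := h x y.
Qed.

(** All four triples of the inner points 0 to 3, three of them nested at the outer points 4, 5, 6
    and the last at 0. *)
Definition blocks_four : seq (seq nat) :=
  [:: [:: 4; 0; 1; 2]; [:: 5; 0; 1; 3]; [:: 6; 0; 2; 3]; [:: 0; 1; 2; 3]].

Lemma blocks_four_check : design_check 6 4 blocks_four.
Proof. by vm_compute. Qed.

Lemma blocks_ten_check : design_check 15 10 blocks_ten.
Proof. by vm_compute. Qed.

Lemma card_inner (I : finType) : #|[set x : point I | inner x]| = 6 * #|I| + 4.
Proof.
rewrite cardsE -sum1_card big_mkcond big_sumType /=; congr (_ + _); last first.
  by rewrite !big_ord_recl big_ord0.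
transitivity (\sum_(i : I) \sum_(c < 9) (c < 6)).
  by rewrite pair_bigA; apply: eq_bigr => -[i c].
rewrite (eq_bigr (fun=> 6)) ?sum_nat_const 1?mulnC // => i _.
by rewrite !big_ord_recl big_ord0.
Qed.

Lemma incomplete_design (I : finType) (L : seq (nat -> point I)) : incomplete L ->
  exists (T : finType) (X : {set T}) (blocks : seq {set T}) (phi : 'I_(size blocks) -> T),
    #|T| = 9 * #|I| + 7 /\ is_BIBD X (6 * #|I| + 4) 3 2 blocks /\ strong_nesting phi.
Proof.
move=> [triL starL]; pose X := [set x : point I | inner x].
pose H : seq (nat -> point I) := [seq (fun k => inr (q k)) | q <- quads_of 6 blocks_four].
have HE S x y : covers S H x y =
    if (x, y) is (inr h, inr h') then covers S (quads_of 6 blocks_four) h h' else 0.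
  by rewrite /covers big_map; case: x y => [u|h] [v|h'] /=; [| | |exact: eq_bigr];
    apply: big1 => q _; apply: big1 => s _; rewrite ?andbF.
have catE S x y : covers S (L ++ H) x y = covers S L x y + covers S H x y.
  by rewrite /covers big_cat.
have [|x y|blocks [phi [dB nB]]] := @quad_design (point I) X (L ++ H).
- move=> x y; rewrite catE triL HE !inE; case: x y => [u|h] [v|h'];
    rewrite ?andbT ?addn0 //= ?andbT //.
  by rewrite !andbF muln0 add0n; case: (design_checkP blocks_four_check h h').
- rewrite catE HE; have := starL x y; case: x y => [u|h] [v|h'] /=; rewrite ?andbT ?addn0 //.
  rewrite andbF leqn0 => /eqP ->; rewrite add0n.
  by case: (design_checkP blocks_four_check h h').
exists (point I), X, blocks, phi; rewrite -card_inner; split=> //.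
by rewrite card_sum card_prod !card_ord; lia.
Qed.

Definition fillable u := exists2 I : finType, #|I| = u & exists L, incomplete (I := I) L.

Lemma fillable_mul (G : finZmodType) (B : seq (seq (nat * G))) u :
  frame B -> odd u -> fillable u -> fillable (#|G| * u).
Proof.
move=> [vB triB starB] ou [I cI [L incL]]; rewrite -cI in ou *.
have [mu muT] := transversal_exists ou.
exists (G * I)%type; first by rewrite card_prod.
by exists (inflate_fill mu B L); apply: inflate_fill_incomplete.
Qed.

Lemma frame_gf9 : frame base_gf9.
Proof.
have /andP [vB /allP cB] := gf9_frame_check.
have memz z : z \in all_gf9.
  by case: z => x y; apply/allpairsP; exists (x, y); rewrite !mem_residues.
by split=> // a b z; have /andP [/eqP ? ?] := allP (allP (cB _ (ord_iota a)) _ (ord_iota b)) z (memz z).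
Qed.

(** A prime factor p >= 5 is split off with the frame over F_p. Without such a factor u is a power
    of 3, and beyond 3 and 9 a factor 9 is split off with the frame over F_9. *)
Lemma fillable_odd u : odd u -> 1 < u -> fillable u.
Proof.
elim/ltn_ind: u => u IH ou u1.
have [p5|p5] := ltnP 4 (max_pdiv u).
  have p_pr := max_pdiv_prime u1; have [m em] := dvdnP (max_pdiv_dvd u).
  move: (max_pdiv u) p5 p_pr em => p p5 p_pr em.
  have [m1|m1] := leqP m 1.
    have -> : u = p by move: m1; case: (m) em ou => [|[|]] // em; lia.
    by exists 'F_p; [rewrite card_Fp | exact: incomplete_prime].
  have om : odd m by move: ou; rewrite em oddM => /andP [].
  have -> : u = #|'F_p| * m by rewrite card_Fp // mulnC.
  apply: (fillable_mul (frame_prime p_pr p5) om); apply: IH => //.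
  by rewrite em ltn_Pmulr //; lia.
(* The largest prime divisor is at most 4 and is not 2, so it is 3. *)
have three v : odd v -> 1 < v -> max_pdiv v <= 4 -> 3 %| v.
  move=> ov v1 pv; have := max_pdiv_prime v1; have := max_pdiv_dvd v.
  move: (max_pdiv v) pv => [|[|[|[|[|//]]]]] // _ + _ //.
  by rewrite dvdn2 ov.
have /dvdnP [v ev] := three u ou u1 p5.
have ov : odd v by move: ou; rewrite ev oddM => /andP [].
have [v1|v1] := leqP v 1.
  have -> : u = 3 by move: v1; case: (v) ev ou => [|[|]] // ->.
  by exists 'I_3; [rewrite card_ord | exact: incomplete_three].
have pv : max_pdiv v <= 4.
  apply: leq_trans p5; apply: max_pdiv_max; rewrite mem_primes max_pdiv_prime //=.
  by rewrite (leq_trans _ u1) // ev dvdn_mulr // max_pdiv_dvd.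
have /dvdnP [w ew] := three v ov v1 pv.
have ow : odd w by move: ov; rewrite ew oddM => /andP [].
have uw : u = 9 * w by rewrite ev ew; lia.
have [w1|w1] := leqP w 1.
  have -> : u = 9 by move: w1; case: (w) uw ow => [|[|]] // ->.
  by exists 'I_9; [rewrite card_ord | exact: incomplete_nine].
have -> : u = #|{: 'I_3 * 'I_3}| * w by rewrite card_prod card_ord.
apply: (fillable_mul frame_gf9 ow); apply: IH => //; lia.
Qed.

Theorem theorem4p9 (t : nat) : t != 1 ->
  (exists (T : finType) (X : {set T}) (blocks : seq {set T})
          (phi : 'I_(size blocks) -> T),
     #|T| = 18 * t + 16 /\ is_BIBD X (12 * t + 10) 3 2 blocks /\
     strong_nesting phi) /\
  (forall (T : finType) (X : {set T}) (blocks : seq {set T})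
          (phi : 'I_(size blocks) -> T),
     is_BIBD X (12 * t + 10) 3 2 blocks -> strong_nesting phi ->
     18 * t + 16 <= #|T|).
Proof.
move=> _; split; last by move=> T X blocks phi; apply: nesting_lower_bound.
case: t => [|t].
  pose X := [set x : 'I_16 | x < 10].
  have [x y|x y|blocks [phi [dB nB]]] := @quad_design 'I_16 X (quads_of 15 blocks_ten).
  - by rewrite !inE; case: (design_checkP blocks_ten_check x y).
  - by case: (design_checkP blocks_ten_check x y).
  exists 'I_16, X, blocks, phi; rewrite card_ord; split=> //.
  suff cX : #|X| = 10 by rewrite cX in dB.
  by rewrite cardsE -sum1_card big_mkcond !big_ord_recl big_ord0.
have [I cI [L /incomplete_design]] := @fillable_odd (2 * t.+1 + 1) ltac:(lia) ltac:(lia).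
have -> : 18 * t.+1 + 16 = 9 * #|I| + 7 by lia.
by have -> : 12 * t.+1 + 10 = 6 * #|I| + 4 by lia.
Qed.
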